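(* Let $c>0$ be a constant and, for each positive integer $n$ with $c/n<1$, let $\mu_{\mathrm{G}}(n,n,c/n)$ denote the matching size obtained by the \textsc{greedy} algorithm on the random bipartite graph $G(n,n,c/n)$. Then asymptotically almost surely, $$\frac{\mu_{\mathrm{G}}(n,n,c/n)}{n} = 1-\frac{\log(2-e^{-c})}{c} + o(1),$$ i.e. for every $\varepsilon>0$, $\mathbb{P}\left(\left|\frac{\mu_{\mathrm{G}}(n,n,c/n)}{n} - \left(1-\frac{\log(2-e^{-c})}{c}\right)\right|>\varepsilon\right)\to 0$ as $n\to\infty$.
   Context: For a positive integer $n$ and $p\in(0,1)$, $G(n,n,p)$ is the random bipartite graph with a set $I$ of $n$ ''bins'' and a set $J$ of $n$ ''balls'', each pair $(i,j)\in I\times J$ being an edge independently with probability $p$. Online model: balls arrive one at a time in a fixed order; when ball $j$ arrives its neighboring bins are revealed and the algorithm must immediately and irrevocably match $j$ to an unmatched bin or drop it; each bin is matched at most once. The matching size is the number of matched balls. The \textsc{greedy} algorithm: when ball $j$ arrives, let $U(j)$ be the set of currently unmatched neighboring bins; if $U(j)\neq\emptyset$, match $j$ to a bin chosen uniformly at random from $U(j)$, otherwise drop $j$. ''Asymptotically almost surely'' means with probability $1-o(1)$ as $n\to\infty$; $\log$ is the natural logarithm. *)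

(* Defs.v *)
From HB Require Import structures.
From mathcomp Require Import all_boot all_order all_algebra all_fingroup.
From mathcomp Require Import reals.

Set Implicit Arguments.
Unset Strict Implicit.
Unset Printing Implicit Defensive.

Import Order.TTheory GRing.Theory Num.Theory.
Local Open Scope ring_scope.

(* The bins I and the balls J are both labelled by 'I_n, and a pair (i, j)
   always lists the bin first. Graphs and (partial) matchings are sets of such
   pairs. *)
Notation bin n := 'I_n (only parsing).
Notation ball n := 'I_n (only parsing).
Notation bigraph n := {set bin n * ball n}.

Section Gnnp.
Variables (R : realType) (n : nat).
Implicit Types (G M : bigraph n) (j : ball n) (js : seq (ball n)).

(* The probability that G(n,n,p) equals G: the n^2 pairs are independent. *)
Definition Gnnp_mass (p : R) G : R :=
  \prod_(e : bin n * ball n) (if e \in G then p else 1 - p).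

Definition matched_bins M : {set bin n} := [set e.1 | e in M].
Definition matched_balls M : {set ball n} := [set e.2 | e in M].
Definition matching_size M : nat := #|matched_balls M|.

(* The set U(j) when the current partial matching is M. *)
Definition unmatched_nbrs G M j : {set bin n} :=
  [set i | (i, j) \in G] :\: matched_bins M.

(* The probability that the final matching satisfies E when greedy runs on the
   graph G, the current matching is M, and the balls js are still to arrive, in
   this order. The sum averages over the uniform choice of a bin in U(j). *)
Fixpoint greedy_prob G js M (E : pred (bigraph n)) : R :=
  if js is j :: js' then
    let U := unmatched_nbrs G M j in
    if U == set0 then greedy_prob G js' M E
    else (\sum_(i in U) greedy_prob G js' ((i, j) |: M) E) / #|U|%:R
  else (E M)%:R.

(* [arrival t] is the ball that arrives at time t. *)
Definition arrival_seq (arrival : {perm 'I_n}) : seq (ball n) :=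
  [seq arrival t | t <- enum 'I_n].

(* The probability, over both G(n,n,p) and the choices made by greedy, that the
   matching obtained satisfies E. *)
Definition greedy_Gnnp_prob (p : R) (arrival : {perm 'I_n})
    (E : pred (bigraph n)) : R :=
  \sum_(G : bigraph n)
     Gnnp_mass p G * greedy_prob G (arrival_seq arrival) set0 E.

Lemma Gnnp_mass_sum1 (p : R) : \sum_(G : bigraph n) Gnnp_mass p G = 1.
Proof.
transitivity (\prod_(e : bin n * ball n) (p + (1 - p))).
  by rewrite bigA_distr; apply: eq_bigl => G; rewrite inE.
by rewrite big1 // => e _; rewrite addrC subrK.
Qed.

Lemma greedy_prob_predT G js M : greedy_prob G js M predT = 1.
Proof.
elim: js M => [|j js IHjs] M //=; case: ifPn => // U0.
under eq_bigr do rewrite IHjs.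
by rewrite sumr_const divff // pnatr_eq0 cards_eq0.
Qed.

Lemma greedy_Gnnp_prob_predT (p : R) (arrival : {perm 'I_n}) :
  greedy_Gnnp_prob p arrival predT = 1.
Proof.
rewrite /greedy_Gnnp_prob -[RHS](Gnnp_mass_sum1 p).
by apply: eq_bigr => G _; rewrite greedy_prob_predT mulr1.
Qed.

End Gnnp.

(* Main.v *)
Require Import Defs.
From HB Require Import structures.
From mathcomp Require Import all_boot all_order all_algebra all_fingroup.
From mathcomp Require Import ring.
From mathcomp Require Import all_classical reals topology normedtype sequences exp.
(* Restores the names of finset and Defs that the analysis libraries shadow. *)
From mathcomp Require Import finset.
Import Defs.

Import Order.TTheory GRing.Theory Num.Theory.
Import numFieldNormedType.Exports.
Local Open Scope ring_scope.

(* Put p = c / n and q = 1 - p. Edges at an arriving ball are independent of the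
   past, so the number u of unmatched bins is a Markov chain, started at n, that
   decreases by 1 with probability 1 - q^u. For Y = q^-u this gives
   E[Y' - 1 | Y] = q (Y - 1) and Var[Y' | Y] = p^2 (Y - 1). Hence after n balls
   Y has mean b = 2 - q^n and variance at most n p^2 (q^-n - 1) = O(1/n), and
   Chebyshev's inequality concentrates Y around b. Since Y and b are at least 1,
   |ln Y - ln b| <= |Y - b|, and ln Y = (u / n) (- ln q^n) where q^n --> e^-c,
   so that u / n concentrates around ln (2 - e^-c) / c. *)

(** * Independence of edges in the random bipartite graph *)

Section ExpectationOverGnnp.
Variables (R : realType) (n : nat) (p : R).
Implicit Types (G H S : bigraph n) (F A B : bigraph n -> R).

Definition Gnnp_expect F : R := \sum_(G : bigraph n) Gnnp_mass p G * F G.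

Definition depends_on S F := forall G H, G :&: S = H :&: S -> F G = F H.

Definition splice S G H : bigraph n := (G :&: S) :|: (H :&: ~: S).

Lemma in_splice S G H e :
  (e \in splice S G H) = if e \in S then e \in G else e \in H.
Proof. by rewrite !inE; case: (e \in S); rewrite ?andbT ?andbF ?orbF. Qed.

(* Exchanging the parts of two independent graphs outside S preserves their
   joint law. *)
Lemma Gnnp_expectM S A B : depends_on S A -> depends_on (~: S) B ->
  Gnnp_expect (fun G => A G * B G) = Gnnp_expect A * Gnnp_expect B.
Proof.
move=> depA depB.
have eA G H : A (splice S G H) = A G.
  apply: depA; apply/setP => e; rewrite [LHS]inE [RHS]inE in_splice.
  by case: (e \in S); rewrite ?andbF.
have eB G H : B (splice S G H) = B H.
  apply: depB; apply/setP => e; rewrite !in_setI in_setC in_splice.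
  by case: (e \in S); rewrite ?andbF.
(* The factor [1] is the total mass of a second independent graph [H], which turns both sides into
   sums over pairs of graphs. *)
rewrite -[LHS]mulr1 -(@Gnnp_mass_sum1 R n p) /Gnnp_expect !mulr_suml.
under eq_bigr do rewrite mulr_sumr.
under [RHS]eq_bigr do rewrite mulr_sumr.
rewrite !pair_big /=.
pose swap (x : bigraph n * bigraph n) := (splice S x.1 x.2, splice S x.2 x.1).
have swapK : involutive swap.
  move=> [G H]; congr (_, _); apply/setP => e; rewrite !in_splice /=;
    by case: (e \in S).
rewrite [RHS](reindex_inj (inv_inj swapK)) /=.
apply: eq_bigr => -[G H] _ /=; rewrite eA eB.
have massM : Gnnp_mass p (splice S G H) * Gnnp_mass p (splice S H G)
    = Gnnp_mass p G * Gnnp_mass p H.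
  rewrite /Gnnp_mass -!big_split; apply: eq_bigr => e _ /=.
  by rewrite !in_splice; case: (e \in S) => //; rewrite mulrC.
by rewrite mulrACA massM; ring.
Qed.

(** Giving weight [0] to the presence of an edge of [S] kills exactly the graphs that meet [S];
    expanding the product over all pairs then yields the sum over graphs. *)
Lemma Gnnp_expect_disjoint S :
  Gnnp_expect (fun G => (G :&: S == set0)%:R) = (1 - p) ^+ #|S|.
Proof.
rewrite -prodr_const big_mkcond /=.
transitivity (\prod_(e : bin n * ball n)
                ((if e \in S then 0 else p) + (1 - p))); last first.
  by apply: eq_bigr => e _; case: ifP; rewrite ?add0r // addrC subrK.
rewrite bigA_distr /Gnnp_expect; apply: eq_big => [G|G _]; first by rewrite inE.
case: (set_0Vmem (G :&: S)) => [GS0|[e]].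
  rewrite GS0 eqxx mulr1; apply: eq_bigr => e _.
  case: ifP => // eG; case: ifP => // eS.
  by move/setP/(_ e): GS0; rewrite !inE eG eS.
rewrite inE => /andP[eG eS].
have /negPf-> : G :&: S != set0 by apply/set0Pn; exists e; rewrite inE eG.
by rewrite mulr0 (bigD1 e) //= eG eS mul0r.
Qed.

End ExpectationOverGnnp.

Arguments Gnnp_expect {R n}.
Arguments depends_on {R n}.
Arguments Gnnp_expectM {R n p}.

(** * Reduction of greedy to a Markov chain on the number of unmatched bins *)

Section Greedy.
Variables (R : realType) (n : nat).
Implicit Types (G H M : bigraph n) (j : ball n) (js : seq (ball n)).

Lemma eq_unmatched_nbrs G H M j :
    (forall i, ((i, j) \in G) = ((i, j) \in H)) ->
  unmatched_nbrs G M j = unmatched_nbrs H M j.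
Proof. by move=> GH; apply/setP => i; rewrite !inE GH. Qed.

Lemma eq_greedy_prob G H js M (E : pred (bigraph n)) :
    (forall i j, j \in js -> ((i, j) \in G) = ((i, j) \in H)) ->
  greedy_prob R G js M E = greedy_prob R H js M E.
Proof.
elim: js M => //= j js IHjs M GH.
rewrite (@eq_unmatched_nbrs G H) => [|i]; last by rewrite GH ?mem_head.
have {}IHjs M' : greedy_prob R G js M' E = greedy_prob R H js M' E.
  by apply: IHjs => i k kjs; rewrite GH // in_cons kjs orbT.
by rewrite IHjs; case: ifP => // _; congr (_ / _); apply: eq_bigr => i _.
Qed.

Lemma matched_binsU1 M i j :
  matched_bins ((i, j) |: M) = i |: matched_bins M.
Proof. exact: imsetU1. Qed.

Lemma matched_ballsU1 M i j :
  matched_balls ((i, j) |: M) = j |: matched_balls M.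
Proof. exact: imsetU1. Qed.

(* The transition operator of the number u of unmatched bins when q = 1 - p: an
   arriving ball is dropped exactly when it has no edge to any of the u bins.
   The junk value at u = 0 has weight 0. *)
Definition bins_step (q : R) (f : nat -> R) (u : nat) : R :=
  q ^+ u * f u + (1 - q ^+ u) * f u.-1.

Definition column j : bigraph n := [set e | e.2 == j].

Lemma unmatched_nbrs_column G H M j :
  G :&: column j = H :&: column j ->
  unmatched_nbrs G M j = unmatched_nbrs H M j.
Proof.
move=> GH; apply: eq_unmatched_nbrs => i.
by move/setP/(_ (i, j)): GH; rewrite !inE eqxx !andbT.
Qed.

(** The event means that [G] avoids the rectangle formed by the unmatched bins and [j]. *)
Lemma Gnnp_expect_no_unmatched_nbrs (p : R) M j :
  Gnnp_expect p (fun G => (unmatched_nbrs G M j == set0)%:R)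
    = (1 - p) ^+ (n - #|matched_bins M|)%N.
Proof.
have -> : (n - #|matched_bins M|)%N = #|setX (~: matched_bins M) [set j]|.
  by rewrite cardsX cards1 muln1 [RHS]cardsCs setCK card_ord.
rewrite -Gnnp_expect_disjoint; apply: eq_bigr => G _.
congr (_ * (nat_of_bool _)%:R); apply/set0Pn/set0Pn => -[].
  by move=> i; rewrite !inE => /andP[iM ij];
    exists (i, j); rewrite !inE ij iM /=.
by move=> [i k]; rewrite !inE => /= /and3P[ij iM /eqP kj];
  exists i; rewrite !inE iM -kj.
Qed.

(** Branch-free form of the recursion: the sum ranges over all bins, whatever [G] is, so it commutes
    with the expectation over [G]. *)
Lemma greedy_prob_cons G j js M (E : pred (bigraph n)) :
  let U := unmatched_nbrs G M j in
  greedy_prob R G (j :: js) M E =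
    (U == set0)%:R * greedy_prob R G js M E
    + \sum_i (i \in U)%:R / #|U|%:R * greedy_prob R G js ((i, j) |: M) E.
Proof.
move=> /=; case: eqP => [->|_].
  by rewrite mul1r big1 ?addr0 // => i _; rewrite inE !mul0r.
rewrite mul0r add0r mulr_suml big_mkcond; apply: eq_bigr => i _ /=.
by case: (i \in _); rewrite ?mul0r // mul1r mulrC.
Qed.

Lemma sum_unmatched_nbrs_weight G M j :
  let U := unmatched_nbrs G M j in
  \sum_i ((i \in U)%:R / #|U|%:R : R) = 1 - (U == set0)%:R.
Proof.
move=> /=; set U := unmatched_nbrs _ _ _; rewrite -mulr_suml -natr_sum.
rewrite -[X in X%:R / _](_ : #|U| = _); last first.
  by rewrite -sum1_card big_mkcond /=; apply: eq_bigr => i _; case: (i \in U).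
case: eqP => [->|/eqP U0]; first by rewrite cards0 mul0r subrr.
by rewrite divff ?subr0 // pnatr_eq0 cards_eq0.
Qed.

(** Induction on [js]: the column of the arriving ball is independent of the later ones, and by
    induction the value after a match does not depend on which free bin was taken. Equality of the
    two cardinals makes [n - u] the final matching size. *)
Lemma greedy_matching_size_chain (p : R) (e : pred nat) js M :
    uniq js -> #|matched_balls M| = #|matched_bins M| ->
    (forall j, j \in js -> j \notin matched_balls M) ->
  Gnnp_expect p (fun G => greedy_prob R G js M (fun M' => e (matching_size M')))
    = iter (size js) (bins_step (1 - p)) (fun u => (e (n - u)%N)%:R)
        (n - #|matched_bins M|)%N.
Proof.
set E := fun M' : bigraph n => e (matching_size M').
elim: js M => [|j js IHjs] M /=.
  move=> _ MM _; rewrite /Gnnp_expect -mulr_suml Gnnp_mass_sum1 mul1r.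
  rewrite subKn; last by rewrite -[leqRHS]card_ord max_card.
  by rewrite /E /matching_size MM.
move=> /andP[jjs js_uniq] MM jsM.
(* Since [j] does not recur in [js], the rest of the run never reads its column. *)
have dep_later M' : depends_on (~: column j) (fun G => greedy_prob R G js M' E).
  move=> G H GH; apply: eq_greedy_prob => i k kjs.
  move/setP/(_ (i, k)): GH; rewrite !inE /=.
  have -> : k != j by apply: contraNneq jjs => <-.
  by rewrite !andbT.
have IHM := IHjs M js_uniq MM
  (fun k kjs => jsM k (mem_behead (s := j :: js) kjs)).
have IHU i : i \notin matched_bins M ->
    Gnnp_expect p (fun G => greedy_prob R G js ((i, j) |: M) E)
    = iter (size js) (bins_step (1 - p)) (fun u => (e (n - u)%N)%:R)
        (n - #|matched_bins M|).-1%N.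
  move=> iM; rewrite IHjs //.
  - by rewrite matched_binsU1 cardsU1 iM addnC subnDA subn1.
  - by rewrite matched_binsU1 matched_ballsU1 !cardsU1 iM jsM ?mem_head // MM.
  - move=> k kjs; rewrite matched_ballsU1 !inE negb_or jsM ?inE ?kjs ?orbT //.
    by rewrite andbT; apply: contraNneq jjs => <-.
transitivity
  (Gnnp_expect p (fun G => (unmatched_nbrs G M j == set0)%:R
                            * greedy_prob R G js M E)
   + \sum_i Gnnp_expect p (fun G => (i \in unmatched_nbrs G M j)%:R
                                     / #|unmatched_nbrs G M j|%:R
                                     * greedy_prob R G js ((i, j) |: M) E)).
  rewrite /Gnnp_expect exchange_big -big_split; apply: eq_bigr => G _ /=.
  by rewrite -mulr_sumr -mulrDr -greedy_prob_cons.
rewrite (Gnnp_expectM (column j)) //; last first.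
  by move=> G H /unmatched_nbrs_column ->.
rewrite Gnnp_expect_no_unmatched_nbrs IHM /bins_step; congr (_ + _).
set v := iter _ _ _ _.
(* The value after taking any free bin is [v]; a bin already matched has weight [0], so [v] can
   stand there too. *)
transitivity (\sum_i Gnnp_expect p (fun G => (i \in unmatched_nbrs G M j)%:R
                                     / #|unmatched_nbrs G M j|%:R) * v).
  apply: eq_bigr => i _; rewrite (Gnnp_expectM (column j)) //; last first.
    by move=> G H /unmatched_nbrs_column ->.
  case: (boolP (i \in matched_bins M)) => [iM|/IHU -> //].
  suff -> : Gnnp_expect p (fun G => (i \in unmatched_nbrs G M j)%:R
                                     / #|unmatched_nbrs G M j|%:R) = 0.
    by rewrite !mul0r.
  by apply: big1 => G _; rewrite !inE iM !mul0r mulr0.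
rewrite -mulr_suml; congr (_ * _).
rewrite -(Gnnp_expect_no_unmatched_nbrs p M j).
rewrite -[X in _ = X - _](Gnnp_mass_sum1 n p).
rewrite /Gnnp_expect exchange_big -sumrB; apply: eq_bigr => G _ /=.
by rewrite -mulr_sumr sum_unmatched_nbrs_weight mulrBr mulr1.
Qed.

Lemma greedy_Gnnp_prob_chain (p : R) (arrival : {perm 'I_n}) (e : pred nat) :
  greedy_Gnnp_prob p arrival (fun M => e (matching_size M))
    = iter n (bins_step (1 - p)) (fun u => (e (n - u)%N)%:R) n.
Proof.
have no_bins : matched_bins (set0 : bigraph n) = set0 by apply: imset0.
have no_balls : matched_balls (set0 : bigraph n) = set0 by apply: imset0.
have js_size : size (arrival_seq arrival) = n by rewrite size_map size_enum_ord.
rewrite -[LHS]/(Gnnp_expect p _) greedy_matching_size_chain.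
- by rewrite js_size no_bins cards0 subn0.
- by rewrite map_inj_uniq ?enum_uniq //; apply: perm_inj.
- by rewrite no_bins no_balls !cards0.
- by move=> j _; rewrite no_balls inE.
Qed.

End Greedy.

(** * Monotonicity and second moment of the chain *)

Section BinsChain.
Variables (R : realType) (q : R).
Hypotheses (q_gt0 : 0 < q) (q_le1 : q <= 1).
Implicit Types (f g : nat -> R).

Lemma ler_bins_step f g u : (forall v, (v <= u)%N -> f v <= g v) ->
  bins_step R q f u <= bins_step R q g u.
Proof.
move=> fg; have qu_le1 : q ^+ u <= 1 by rewrite exprn_ile1 // ltW.
by rewrite lerD // ler_wpM2l ?fg ?leq_pred // ?subr_ge0 // exprn_ge0 // ltW.
Qed.

(** The chain never increases, so comparing [f] and [g] up to the starting state is enough. *)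
Lemma ler_iter_bins_step f g k u : (forall v, (v <= u)%N -> f v <= g v) ->
  iter k (bins_step R q) f u <= iter k (bins_step R q) g u.
Proof.
elim: k u => [|k IHk] u fg /=; first exact: fg.
apply: ler_bins_step => v vu; apply: IHk => w wv.
by apply: fg; apply: leq_trans vu.
Qed.

Lemma iter_bins_stepZ (a : R) f k u :
  iter k (bins_step R q) (fun v => a * f v) u
    = a * iter k (bins_step R q) f u.
Proof. by elim: k u => //= k IHk u; rewrite /bins_step !IHk; ring. Qed.

(* With Y = q^-u, one step has E[Y'] - 1 = q (Y - 1) and conditional variance
   (1 - q)^2 (Y - 1). *)
Lemma iter_bins_step_square_le (b : R) k u :
  iter k (bins_step R q) (fun v => (q ^- v - b) ^+ 2) u
    <= (1 + q ^+ k * (q ^- u - 1) - b) ^+ 2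
       + k%:R * (1 - q) ^+ 2 * (q ^- u - 1).
Proof.
elim: k u => [|k IHk] u; first by rewrite /= mul0r mul0r addr0 mul1r subrKC.
rewrite iterS; apply: (le_trans (ler_bins_step _ _ _ (fun v _ => IHk v))).
rewrite /bins_step; case: u => [|v].
  (* With no unmatched bin left, both sides equal [(1 - b) ^+ 2]. *)
  by rewrite /= !expr0 invr1 subrr !mulr0 mul1r mul0r !addr0.
rewrite [v.+1.-1]/=.
have Yge1 : 1 <= q ^- v.+1 by rewrite invf_ge1 ?exprn_gt0 // exprn_ile1 // ltW.
set Y := q ^- v.+1 in Yge1 *.
have -> : q ^+ v.+1 = Y^-1 by rewrite invrK.
have -> : q ^- v = q * Y by rewrite /Y exprS invfM mulVKf ?gt_eqF.
have Y0 : Y != 0 by rewrite gt_eqF // (lt_le_trans ltr01).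
set Q := q ^+ k; have Q_le1 : Q ^+ 2 <= 1.
  by rewrite !exprn_ile1 ?exprn_ge0 // ltW.
rewrite [q ^+ k.+1]exprS -/Q -natr1; set K : R := k%:R.
have K0 : 0 <= K by rewrite ler0n.
(* The mean of a square is the square of the mean plus the variance: the latter adds
   [Q ^+ 2 * (1 - q) ^+ 2 * (Y - 1)], while the old error term shrinks by [q]. *)
rewrite [leLHS](_ : _ = (1 + q * Q * (Y - 1) - b) ^+ 2
    + (Q ^+ 2 + K * q) * (1 - q) ^+ 2 * (Y - 1)); last by field.
rewrite lerD2l ler_wpM2r ?subr_ge0 // ler_wpM2r ?sqr_ge0 //.
by rewrite addrC lerD // ler_piMr.
Qed.

End BinsChain.

(** * Probability bounds for greedy by comparison of chains *)

Lemma greedy_Gnnp_prob_ge0 (R : realType) (n : nat) (p : R)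
    (arrival : {perm 'I_n}) (e : pred nat) : 0 <= p < 1 ->
  0 <= greedy_Gnnp_prob p arrival (fun M => e (matching_size M)).
Proof.
move=> /andP[p0 p1]; rewrite greedy_Gnnp_prob_chain.
(* Zero is written as the chain applied to [0 * f], so that monotonicity applies. *)
set f := fun u : nat => _; rewrite -(mul0r (iter n (bins_step R (1 - p)) f n)).
rewrite -iter_bins_stepZ; apply: ler_iter_bins_step => [||v _].
- by rewrite subr_gt0.
- by rewrite gerBl.
- by rewrite mul0r ler0n.
Qed.

(** Chebyshev's inequality: [d ^+ 2] times the indicator of the event is at most the squared
    deviation. *)
Lemma greedy_Gnnp_prob_le (R : realType) (n : nat) (p : R)
    (arrival : {perm 'I_n}) (e : pred nat) (d : R) :
    0 <= p < 1 -> 0 < d ->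
    (forall u, (u <= n)%N -> e (n - u)%N ->
       d <= `|(1 - p) ^- u - (2 - (1 - p) ^+ n)|) ->
  greedy_Gnnp_prob p arrival (fun M => e (matching_size M))
    <= n%:R * p ^+ 2 * ((1 - p) ^- n - 1) / d ^+ 2.
Proof.
move=> /andP[p0 p1] d0 far; set q := 1 - p in far *.
have q0 : 0 < q by rewrite subr_gt0.
have q1 : q <= 1 by rewrite gerBl.
rewrite greedy_Gnnp_prob_chain -/q ler_pdivlMr ?exprn_gt0 // mulrC.
rewrite -iter_bins_stepZ.
apply: (@le_trans _ _
  (iter n (bins_step R q) (fun v => (q ^- v - (2 - q ^+ n)) ^+ 2) n)).
  apply: ler_iter_bins_step => // v vn.
  case: (boolP (e _)) => [/(far v vn) dv|_].
    by rewrite mulr1 -[leRHS]real_normK ?num_real // lerXn2r ?nnegrE // ltW.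
  by rewrite mulr0 sqr_ge0.
apply: (le_trans (iter_bins_step_square_le _ _ q0 q1 _ _ _)).
(* The centre [2 - q ^+ n] is the exact mean after [n] steps from [n], so the squared bias
   vanishes. *)
rewrite mulrBr mulr1 divff; last by rewrite gt_eqF // exprn_gt0.
rewrite (_ : 1 - q = p); last by rewrite /q; ring.
by rewrite [X in X ^+ 2](_ : _ = 0) ?expr0n ?add0r //; ring.
Qed.

(** For [1 <= y <= x], [ln (x / y) <= (x - y) / y <= x - y]. *)
Lemma ln_dist_le (R : realType) (x y : R) :
  1 <= x -> 1 <= y -> `|ln x - ln y| <= `|x - y|.
Proof.
wlog yx : x y / y <= x => [th x1 y1|x1 y1].
  case/orP: (le_total y x) => xy; first exact: th.
  by rewrite distrC [leRHS]distrC; exact: th.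
have y0 : 0 < y by apply: lt_le_trans y1.
have x0 : 0 < x by apply: lt_le_trans x1.
rewrite !ger0_norm ?subr_ge0 ?ler_ln // -ln_div //.
have -> : x / y = 1 + (x - y) / y by rewrite mulrBl divff ?gt_eqF // subrKC.
have xy0 : 0 <= (x - y) / y by rewrite divr_ge0 ?subr_ge0 // ltW.
apply: le_trans (le_ln1Dx _) _; first by rewrite (lt_le_trans _ xy0) // ltrN10.
by rewrite ler_pdivrMr // ler_peMr ?subr_ge0.
Qed.

(** * Limits in [n] and the passage from [q ^- u] to [u / n] *)

Local Open Scope classical_set_scope.

Lemma cvg_divn (R : realType) (c : R) :
  (fun n : nat => c / n%:R) @ \oo --> (0 : R).
Proof.
rewrite -(mulr0 c); apply: cvgM; first exact: cvg_cst.
by rewrite -cvg_shiftS; exact: cvg_harmonic.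
Qed.

(** With [x = c / n], the bounds [expR (- (x / (1 - x))) <= 1 - x <= expR (- x)] are raised to the
    power [n]. *)
Lemma cvg_subr_divn_exprn (R : realType) (c : R) : 0 < c ->
  (fun n : nat => (1 - c / n%:R) ^+ n) @ \oo --> expR (- c).
Proof.
move=> c0.
have cn0 := cvg_divn R c.
apply: (@squeeze_cvgr _ _ _ _ (fun n : nat => expR (- (c / (1 - c / n%:R))))
          (fun=> expR (- c))); last exact: cvg_cst; last first.
  apply: continuous_cvg; first exact: continuous_expR.
  apply: cvgN; rewrite -[X in _ --> X](divr1 c).
  apply: cvgM; first exact: cvg_cst.
  apply: cvgV; first exact: oner_neq0.
  by rewrite -[X in _ --> X]subr0; apply: cvgB => //; exact: cvg_cst.
near=> n.
have n0 : (0 < n)%N by near: n; exact: nbhs_infty_gt.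
have nR0 : 0 < n%:R :> R by rewrite ltr0n.
have cn1 : c / n%:R < 1 by near: n; exact: (cvgr_lt 0).
set x := c / n%:R in cn1 *.
have xE : c = n%:R * x by rewrite /x mulrC divfK ?gt_eqF.
have x0 : 0 < x by rewrite divr_gt0.
have q0 : 0 < 1 - x by rewrite subr_gt0.
rewrite {1 2}xE -mulrA -!(mulrN n%:R) !expRM_natl.
apply/andP; split; apply: lerXn2r; rewrite ?nnegrE ?expR_ge0 // ?(ltW q0) //.
  (* Inverted, the lower bound reads [(1 - x)^-1 = 1 + x / (1 - x) <= expR (x / (1 - x))]. *)
  rewrite expRN -[leRHS]invrK lef_pV2 ?posrE ?expR_gt0 ?invr_gt0 //.
  rewrite (le_trans _ (expR_ge1Dx _)) // le_eqVlt; apply/orP; left; apply/eqP.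
  by field; rewrite gt_eqF.
exact: expR_ge1Dx.
Unshelve. all: by end_near. Qed.

(** Logarithms contract distances on [[1, +oo)], and [ln (q ^- u) = a * (u / n)] with [a >= c]; a
    deviation of at least [eps / 2] in [u / n] thus costs [c * eps / 2] in [q ^- u]. The other
    [eps / 2] absorbs the distance to the limit [L / c]. *)
Lemma unmatched_fraction_far (R : realType) (q c L eps : R) (n u : nat) :
    0 < q < 1 -> 0 < c -> 0 < eps -> (0 < n)%N -> (u <= n)%N ->
    c <= - ln (q ^+ n) ->
    `|ln (2 - q ^+ n) / - ln (q ^+ n) - L / c| < eps / 2 ->
    eps < `|(n - u)%:R / n%:R - (1 - L / c)| ->
  c * eps / 2 <= `|q ^- u - (2 - q ^+ n)|.
Proof.
move=> /andP[q0 q1] c0 eps0 n0 un; set a := - ln _ => ca near_limit far.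
have a0 : 0 < a by apply: lt_le_trans ca.
have nR0 : n%:R != 0 :> R by rewrite pnatr_eq0 -lt0n.
have qn_le1 : q ^+ n <= 1 by rewrite exprn_ile1 // ltW.
have lnY : ln (q ^- u) = a * (u%:R / n%:R).
  have -> : a = - (ln q * n%:R) by rewrite /a lnXn // mulr_natr.
  rewrite lnV ?posrE ?exprn_gt0 // lnXn // -mulr_natr.
  by field.
apply: le_trans (ln_dist_le _ _ _ _ _); last 2 first.
- by rewrite invf_ge1 ?exprn_gt0 // exprn_ile1 // ltW.
- by rewrite lerBrDr (natrD _ 1 1) lerD2l.
have -> : ln (q ^- u) - ln (2 - q ^+ n)
    = a * (u%:R / n%:R - ln (2 - q ^+ n) / a)
  by rewrite lnY; field; rewrite gt_eqF.
rewrite normrM gtr0_norm // -mulrA.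
apply: ler_pM => //; [exact: ltW | by rewrite divr_ge0 // ltW |].
move: far near_limit; rewrite natrB // mulrBl divff //.
set w := u%:R / n%:R; set l := _ / a.
rewrite (_ : 1 - w - (1 - L / c) = - ((w - l) + (l - L / c))); last by ring.
rewrite normrN => far near_limit.
rewrite leNgt; apply/negP => close.
have := lt_trans far (le_lt_trans (ler_normD _ _) (ltrD close near_limit)).
by rewrite -splitr ltxx.
Qed.

(** * Convergence in probability of the matched fraction *)

Theorem theorem3 (R : realType) (c : R) (hc : 0 < c)
    (arrival : forall n : nat, {perm 'I_n}) (eps : R) (heps : 0 < eps) :
  (fun n : nat =>
     greedy_Gnnp_prob (c / n%:R) (arrival n)
       (fun M => eps < `| (matching_size M)%:R / n%:R
                          - (1 - ln (2 - expR (- c)) / c) |))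
    @ \oo --> (0 : R).
Proof.
set L := ln (2 - expR (- c)).
have cn0 := cvg_divn R c.
have qn := cvg_subr_divn_exprn R c hc.
have ec_gt0 := expR_gt0 (- c).
have ec_lt1 : expR (- c) < 1 by rewrite expR_lt1 oppr_lt0.
have an : (fun n : nat => - ln ((1 - c / n%:R) ^+ n)) @ \oo --> c.
  rewrite -[X in _ --> X]opprK -[X in _ --> - X]expRK; apply: cvgN.
  by apply: continuous_cvg => //; exact: continuous_ln.
have ln_b : (fun n : nat => ln (2 - (1 - c / n%:R) ^+ n)
                / - ln ((1 - c / n%:R) ^+ n)) @ \oo --> L / c.
  apply: cvgM; last by apply: cvgV => //; rewrite gt_eqF.
  apply: continuous_cvg.
    by apply: continuous_ln; rewrite subr_gt0 (lt_trans ec_lt1) ?ltr1n.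
  by apply: cvgB => //; exact: cvg_cst.
(* The Chebyshev bound for [p = c / n] and [d = c * eps / 2], with [n * p ^+ 2] rewritten as
   [c * (c / n)] to expose the factor tending to [0]. *)
pose B (n : nat) := c * (c / n%:R) * (((1 - c / n%:R) ^+ n)^-1 - 1)
                    / (c * eps / 2) ^+ 2.
apply: (@squeeze_cvgr _ _ _ _ (fun=> 0) B); last 2 first.
- exact: cvg_cst.
- rewrite -(mul0r ((c * eps / 2) ^- 2))
    -(mul0r ((expR (- c))^-1 - 1)) -(mulr0 c).
  apply: cvgM; last exact: cvg_cst.
  apply: cvgM; first by apply: cvgM => //; exact: cvg_cst.
  apply: cvgB; last exact: cvg_cst.
  by apply: cvgV => //; rewrite gt_eqF.
near=> n.
have n0 : (0 < n)%N by near: n; exact: nbhs_infty_gt.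
have nR0 : 0 < n%:R :> R by rewrite ltr0n.
have cn1 : c / n%:R < 1 by near: n; exact: (cvgr_lt 0).
have near_limit : `|ln (2 - (1 - c / n%:R) ^+ n) / - ln ((1 - c / n%:R) ^+ n)
                    - L / c| < eps / 2.
  by near: n; rewrite near_simpl; apply: cvgr_distC_lt => //; rewrite divr_gt0.
have p0 : 0 < c / n%:R by rewrite divr_gt0.
have q0 : 0 < 1 - c / n%:R by rewrite subr_gt0.
have q1 : 1 - c / n%:R < 1 by rewrite gtrBl.
(* From [ln (1 - x) <= - x]; this is what makes the threshold [c * eps / 2] independent of [n]. *)
have ca : c <= - ln ((1 - c / n%:R) ^+ n).
  rewrite lnXn // -[ln _ *+ n]mulr_natr lerNr -ler_pdivlMr // mulNr.
  by apply: le_ln1Dx; rewrite ltrN2.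
pose e (k : nat) := eps < `|k%:R / n%:R - (1 - L / c)|.
have p01 : 0 <= c / n%:R < 1 by rewrite (ltW p0).
apply/andP; split; first exact: (greedy_Gnnp_prob_ge0 _ _ _ _ e).
have -> : B n = n%:R * (c / n%:R) ^+ 2 * ((1 - c / n%:R) ^- n - 1)
                / (c * eps / 2) ^+ 2.
  congr (_ * _ / _); rewrite expr2 !mulrA; congr (_ / _).
  by rewrite [n%:R * c]mulrC mulfK ?gt_eqF.
apply: (greedy_Gnnp_prob_le _ _ _ _ e) => [//||u un].
- by rewrite divr_gt0 ?mulr_gt0.
- by apply: unmatched_fraction_far near_limit => //; rewrite q0.
Unshelve. all: by end_near. Qed.
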